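(* If $N_1\leftrightarrow_{sp}N_2$ for nets $N_1$ and $N_2$, then $N_1\equiv_{cc}N_2$.
   Context: Petri nets: $N=(S,T,F,M_0,A,\ell)$ with disjoint sets $S$ (places), $T$ (transitions), $F:(S\times T)\cup(T\times S)\to\mathbb N$, initial marking $M_0\in\mathbb N^S$, type $A$, labelling $\ell:T\to A$; ${}^\bullet x(y)=F(y,x)$, $x^\bullet(y)=F(x,y)$; $t$ enabled at $M$ iff ${}^\bullet t\le M$, firing yields $M-{}^\bullet t+t^\bullet$; reachable markings arise from $M_0$ by finite firing sequences. A net is a Petri net with bounded parallelism (no reachable $M$ and multiset $U$ of transitions with infinitely many elements with $\sum_{t\in U}{}^\bullet t\le M$). sp-bisimilarity: for nets $N_i=(S_i,T_i,F_i,M_i,A_i,\ell_i)$, a linking is $l\in\mathbb N^{S_1\times S_2}$ with $\pi_1(l)(s_1)=\sum_{s_2}l(s_1,s_2)$, $\pi_2(l)(s_2)=\sum_{s_1}l(s_1,s_2)$. An sp-bisimulation is a set $\mathcal B$ of linkings such that whenever $c\le l\in\mathcal B$ and $\pi_1(c)={}^\bullet t_1$ ($t_1\in T_1$) there are $t_2\in T_2$ with $\ell_2(t_2)=\ell_1(t_1)$, $\pi_2(c)={}^\bullet t_2$ and a linking $\bar c$ with $\pi_1(\bar c)=t_1^\bullet$, $\pi_2(\bar c)=t_2^\bullet$, $l-c+\bar c\in\mathcal B$, and symmetrically with $N_1,N_2$ exchanged. $N_1\leftrightarrow_{sp}N_2$ iff $A_1=A_2$ and some sp-bisimulation contains $l$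 with $\pi_i(l)=M_i$ ($i=1,2$). Processes: a causal net is a net $\mathcal N=(\mathcal S,\mathcal T,\mathcal F,\mathcal M_0,\mathcal A,\ell_{\mathcal N})$ in which every place has at most one pre- and at most one post-transition, $\mathcal M_0(s)=1$ iff $s$ has no pre-transition (else 0), the transitive closure $\mathcal F^+$ of the flow is irreflexive, and every transition has finitely many $\mathcal F^+$-predecessor transitions. A folding into $N$ maps places to places, transitions to transitions, with $\mathcal A=A$, labels preserved, $\rho(\mathcal M_0)=M_0$, $\rho({}^\bullet t)={}^\bullet\rho(t)$, $\rho(t^\bullet)=\rho(t)^\bullet$ (where $\rho(H)(s)=|\rho^{-1}(s)\cap H|$). A process of $N$ is a pair (causal net, folding into $N$). $\mathcal P'\le\mathcal P$ ($\mathcal P$ extends $\mathcal P'$) iff the places and transitions of $\mathcal P'$ are subsets of those of $\mathcal P$, initial markings coincide, and the flow and folding of $\mathcal P'$ are restrictions of those of $\mathcal P$. A process is maximal if it has no proper extension. A complete causal net of $N$ is the first component of a maximal process of $N$. $N_1\equiv_{cc}N_2$ (complete causal net equivalence) iff $N_1$ and $N_2$ have the same complete causal nets. *)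

(* Defs.v *)
From mathcomp Require Import all_boot.
From mathcomp Require Import all_classical.
From Stdlib Require Import Relation_Operators.

Set Implicit Arguments.
Unset Strict Implicit.
Unset Printing Implicit Defensive.

Local Open Scope classical_set_scope.
Local Open Scope nat_scope.

(** Multisets over [X] are functions [X -> nat], possibly of infinite support.
    The finitely supported big operator is 0 on an infinite support, so a
    possibly infinite sum of naturals is handled as a relation: [sums_to D f n]
    says that the sum of [f] over [D] converges, with value [n]. *)
Definition sums_to (X : choiceType) (D : set X) (f : X -> nat) (n : nat) : Prop :=
  finite_set (D `&` f @^-1` [set~ 0]) /\ \big[addn/0]_(x \in D) f x = n.

Definition mle (X : Type) (f g : X -> nat) : Prop := forall x, f x <= g x.

(** Places and transitions are separate types, hence disjoint.  The flow [F] is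
    given by its two halves, [pre t s] being F(s,t) and [post t s] being F(t,s).
    All actions live in an ambient [Act]; the type of a net is a set of these,
    so that the types of different nets can be compared as sets. *)
Record petri_net (Act : Type) := PetriNet {
  place : choiceType;
  trans : choiceType;
  pre : trans -> place -> nat;
  post : trans -> place -> nat;
  init : place -> nat;
  typ : set Act;
  lab : trans -> Act;
  lab_typ : forall t, typ (lab t) }.

Definition marking (Act : Type) (N : petri_net Act) := place N -> nat.

Definition enabled (Act : Type) (N : petri_net Act) (M : marking N) (t : trans N) :=
  mle (pre t) M.

Definition fire (Act : Type) (N : petri_net Act) (M : marking N) (t : trans N) :
  marking N := fun s => M s - pre t s + post t s.

Definition step (Act : Type) (N : petri_net Act) (M M' : marking N) : Prop :=
  exists t, enabled M t /\ M' = fire M t.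

Definition reachable (Act : Type) (N : petri_net Act) (M : marking N) : Prop :=
  clos_refl_trans (marking N) (@step Act N) (@init Act N) M.

Definition bounded_parallelism (Act : Type) (N : petri_net Act) : Prop :=
  forall (M : marking N) (U : trans N -> nat),
    reachable M -> infinite_set [set t | 0 < U t] ->
    ~ (forall s, exists2 n, sums_to setT (fun t => U t * pre t s) n & n <= M s).

Record net (Act : Type) := Net {
  net_petri :> petri_net Act;
  net_bounded : bounded_parallelism net_petri }.

(** ** Structure preserving bisimilarity *)

Section SpBisimilarity.
Variables (Act : Type) (N1 N2 : petri_net Act).

Definition linking := (place N1 * place N2)%type -> nat.

(** [pi1_is l M] is the equation pi_1(l) = M; in particular every sum defining
    pi_1(l) is finite. *)
Definition pi1_is (l : linking) (M : marking N1) : Prop :=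
  forall s1, sums_to setT (fun s2 => l (s1, s2)) (M s1).

Definition pi2_is (l : linking) (M : marking N2) : Prop :=
  forall s2, sums_to setT (fun s1 => l (s1, s2)) (M s2).

Definition relink (l c c' : linking) : linking := fun p => l p - c p + c' p.

Definition sp_bisimulation (B : set linking) : Prop :=
  (forall (l c : linking) (t1 : trans N1),
     B l -> mle c l -> pi1_is c (pre t1) ->
     exists (t2 : trans N2) (c' : linking),
       [/\ lab t2 = lab t1, pi2_is c (pre t2),
           pi1_is c' (post t1), pi2_is c' (post t2) & B (relink l c c')]) /\
  (forall (l c : linking) (t2 : trans N2),
     B l -> mle c l -> pi2_is c (pre t2) ->
     exists (t1 : trans N1) (c' : linking),
       [/\ lab t1 = lab t2, pi1_is c (pre t1),
           pi1_is c' (post t1), pi2_is c' (post t2) & B (relink l c c')]).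

Definition sp_bisimilar : Prop :=
  typ N1 = typ N2 /\
  exists (B : set linking) (l : linking),
    [/\ sp_bisimulation B, B l,
        pi1_is l (@init Act N1) & pi2_is l (@init Act N2)].

End SpBisimilarity.

(** ** Causal nets and processes *)

Definition flow (Act : Type) (N : petri_net Act)
    (x y : (place N + trans N)%type) : Prop :=
  match x, y with
  | inl s, inr t => 0 < pre t s
  | inr t, inl s => 0 < post t s
  | _, _ => False
  end.

Definition flow_plus (Act : Type) (N : petri_net Act) :=
  clos_trans (place N + trans N)%type (@flow Act N).

(** Pre- and postsets of places are multisets as well, so "at most one" also
    excludes arc weights above 1. *)
Record causal_net (Act : Type) (C : net Act) : Prop := CausalNet {
  cn_post_le1 : forall (t : trans C) s, post t s <= 1;
  cn_post_uniq : forall (t t' : trans C) s, 0 < post t s -> 0 < post t' s -> t = t';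
  cn_pre_le1 : forall (t : trans C) s, pre t s <= 1;
  cn_pre_uniq : forall (t t' : trans C) s, 0 < pre t s -> 0 < pre t' s -> t = t';
  cn_init1 : forall s : place C, (forall t, post t s = 0) -> init s = 1;
  cn_init0 : forall (s : place C) t, 0 < post t s -> init s = 0;
  cn_acyclic : forall x, ~ flow_plus (N := C) x x;
  cn_finite : forall t : trans C,
    finite_set [set u : trans C | flow_plus (N := C) (inr u) (inr t)] }.

(** [image_is rho H K] is the equation rho(H) = K for multisets [H], [K]; it is
    applied to [H] with values in {0,1} only, where the sum is a cardinality. *)
Definition image_is (X : choiceType) (Y : Type) (rho : X -> Y)
    (H : X -> nat) (K : Y -> nat) : Prop :=
  forall y, sums_to [set x | rho x = y] H (K y).

Record folding (Act : Type) (C N : net Act) := Folding {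
  fold_place : place C -> place N;
  fold_trans : trans C -> trans N;
  fold_typ : typ C = typ N;
  fold_lab : forall t, lab (fold_trans t) = lab t;
  fold_init : image_is fold_place (@init Act C) (@init Act N);
  fold_pre : forall t, image_is fold_place (pre t) (pre (fold_trans t));
  fold_post : forall t, image_is fold_place (post t) (post (fold_trans t)) }.

Record process (Act : Type) (N : net Act) := Process {
  proc_net : net Act;
  proc_causal : causal_net proc_net;
  proc_fold : folding proc_net N }.

(** [P <= P'].  Since carriers are types, the inclusions of places and of
    transitions are given as injections [iS] and [iT]. *)
Record extends (Act : Type) (N : net Act) (P P' : process N)
    (iS : place (proc_net P) -> place (proc_net P'))
    (iT : trans (proc_net P) -> trans (proc_net P')) : Prop := Extends {
  ext_place_inj : injective iS;
  ext_trans_inj : injective iT;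
  ext_init : forall s, init (iS s) = init s;
  ext_init_new : forall s', ~ range iS s' -> init s' = 0;
  ext_pre : forall t s, pre (iT t) (iS s) = pre t s;
  ext_post : forall t s, post (iT t) (iS s) = post t s;
  ext_fold_place : forall s,
    fold_place (proc_fold P') (iS s) = fold_place (proc_fold P) s;
  ext_fold_trans : forall t,
    fold_trans (proc_fold P') (iT t) = fold_trans (proc_fold P) t }.

(** An extension is proper unless both inclusions are onto. *)
Definition maximal (Act : Type) (N : net Act) (P : process N) : Prop :=
  forall (P' : process N) iS iT,
    @extends Act N P P' iS iT -> range iS = setT /\ range iT = setT.

Definition complete_causal_net (Act : Type) (N C : net Act) : Prop :=
  exists P : process N, maximal P /\ proc_net P = C.

Definition cc_equiv (Act : Type) (N1 N2 : net Act) : Prop :=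
  forall C : net Act, complete_causal_net N1 C <-> complete_causal_net N2 C.

(* Main.v *)
(** Bounded parallelism makes every depth layer of a causal net finite, so an
    sp-bisimulation can be followed layer by layer along a process [(C, rho1)]
    of [N1].  Each linking met on the way is the image of the current cut of [C]
    under a pair [(rho1, rho2)], and the union of the [rho2] folds [C] into [N2].
    If that process had a proper extension, a minimal new transition would have
    only finitely many causes, all in [C]; its preset would lie in a single cut
    and match a transition of [N1], which would extend [(C, rho1)]. *)

From mathcomp Require Import all_boot.
From mathcomp Require Import all_classical.
From Stdlib Require Import Relation_Operators Operators_Properties.
Require Import Defs.

Set Implicit Arguments.
Unset Strict Implicit.
Unset Printing Implicit Defensive.

Local Open Scope classical_set_scope.
Local Open Scope nat_scope.

(** * Convergent sums of naturals as finite listings *)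

(** A listing enumerates [f] on [D] with multiplicity. It exists exactly when the sum converges, and
    its length is the value, so operations on sequences replace manipulations of big operators. *)
Definition lists (X : eqType) (D : set X) (f : X -> nat) (w : seq X) : Prop :=
  (forall x, D x -> count_mem x w = f x) /\ (forall x, x \in w -> D x).

Lemma count_flatten_nseq (X : eqType) (f : X -> nat) (r : seq X) x :
  uniq r ->
  count_mem x (flatten [seq nseq (f y) y | y <- r]) = (x \in r) * f x.
Proof.
elim: r => [//|a r IH] /= /andP[ar /IH {}IH].
rewrite count_cat IH count_nseq in_cons /= eq_sym.
have [->|_] /= := eqVneq x a; last by [].
by rewrite (negPf ar) mul0n addn0.
Qed.

Lemma listsS (X : eqType) (D : set X) (f g : X -> nat) w :
  lists D f w -> (forall x, D x -> g x <= f x) -> exists w', lists D g w'.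
Proof.
move=> [cw Dw] le_gf; exists (flatten [seq nseq (g y) y | y <- undup w]); split.
  move=> x Dx; rewrite count_flatten_nseq ?undup_uniq// mem_undup.
  case: (boolP (x \in w)) (cw x Dx) (le_gf x Dx) => [_ _ _|]; first by rewrite mul1n.
  by move=> /count_memPn -> <-; rewrite leqn0 => /eqP ->.
by move=> x /flattenP[_ /mapP[y + ->]]; rewrite mem_undup => /Dw Dy /nseqP[->].
Qed.

Lemma lists_finite (X : choiceType) (D : set X) (f : X -> nat) :
  finite_set (D `&` f @^-1` [set~ 0]) -> exists w, lists D f w.
Proof.
move=> /finite_seqP[r rE]; have Dr x : x \in r -> D x /\ f x != 0.
  move=> xr; have : [set` r] x by [].
  by rewrite -rE => -[Dx /eqP fx].
exists (flatten [seq nseq (f y) y | y <- undup r]); split.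
  move=> x Dx; rewrite count_flatten_nseq ?undup_uniq// mem_undup.
  case: (boolP (x \in r)) => [_|xr]; first by rewrite mul1n.
  rewrite mul0n; apply/esym/eqP; apply/negP => fx.
  by case/negP: xr; suff : [set` r] x by []; rewrite -rE; split=> // /eqP.
by move=> x /flattenP[_ /mapP[y + ->]]; rewrite mem_undup => /Dr[Dy _] /nseqP[->].
Qed.

Lemma lists_sums (X : choiceType) (D : set X) (f : X -> nat) w :
  lists D f w -> sums_to D f (size w).
Proof.
move=> [cw Dw]; split.
  apply: (@sub_finite_set _ _ [set` w]) => [x [Dx /eqP fx]|]; last exact: finite_seq.
  by rewrite /mkset -has_pred1 has_count cw// lt0n.
rewrite (fsbigE (undup w)) ?undup_uniq//; first last.
- by move=> x Dx; rewrite mem_undup => /count_memPn; rewrite cw.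
- by move=> x /=; rewrite mem_undup => /Dw.
rewrite -(perm_size (perm_count_undup w)) size_flatten /shape -map_comp.
rewrite sumnE big_map [LHS]big_seq_cond [RHS]big_seq; apply: eq_big => [x|x].
  rewrite mem_undup; case: (boolP (x \in w)) => //= /Dw Dx; exact: mem_set.
by rewrite mem_undup => /andP[xw _]; rewrite /= size_nseq cw//; apply: Dw.
Qed.

Lemma sums_toP (X : choiceType) (D : set X) (f : X -> nat) n :
  sums_to D f n <-> exists2 w, lists D f w & size w = n.
Proof.
split=> [sDf|[w lw <-]]; last exact: lists_sums.
have [w lw] := lists_finite sDf.1; exists w => //.
by rewrite -(lists_sums lw).2 sDf.2.
Qed.

Lemma sums_to_inj (X : choiceType) (D : set X) (f : X -> nat) m n :
  sums_to D f m -> sums_to D f n -> m = n.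
Proof. by move=> [_ <-] [_ <-]. Qed.

Lemma sums_toS (X : choiceType) (D : set X) (f g : X -> nat) n :
  sums_to D f n -> (forall x, D x -> g x <= f x) -> exists m, sums_to D g m.
Proof.
move=> /sums_toP[w lw _] /(listsS lw)[w' lw'].
by exists (size w'); apply: lists_sums.
Qed.

Lemma sums_toD (X : choiceType) (D : set X) (f g : X -> nat) m n :
  sums_to D f m -> sums_to D g n -> sums_to D (fun x => f x + g x) (m + n).
Proof.
move=> /sums_toP[v [cv Dv] <-] /sums_toP[w [cw Dw] <-].
apply/sums_toP; exists (v ++ w); last by rewrite size_cat.
split=> x; first by move=> Dx; rewrite count_cat cv ?cw.
by rewrite mem_cat => /orP[/Dv|/Dw].
Qed.

Lemma sums_to0 (X : choiceType) (D : set X) (f : X -> nat) :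
  (forall x, D x -> f x = 0) -> sums_to D f 0.
Proof. by move=> f0; apply/sums_toP; exists [::]; split=> // x /f0 ->. Qed.

Lemma sums_to_gt0 (X : choiceType) (D : set X) (f : X -> nat) n x :
  sums_to D f n -> D x -> 0 < f x -> 0 < n.
Proof.
move=> /sums_toP[w [cw Dw] <-] Dx; rewrite -cw// -has_count has_pred1.
by case: w {cw Dw}.
Qed.

Lemma sums_to_ex (X : choiceType) (D : set X) (f : X -> nat) n :
  sums_to D f n -> 0 < n -> exists x, D x /\ 0 < f x.
Proof.
move=> /sums_toP[[|x w] [cw Dw] <-]// _.
have Dx : D x by apply: Dw; rewrite mem_head.
by exists x; split=> //; rewrite -cw//= eqxx.
Qed.

(** * Images of multisets under a map *)

Section Image.
Variables (X : choiceType) (Y : Type).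
Implicit Types (f : X -> Y) (H : X -> nat) (K : Y -> nat).

Lemma image_ext f g H K :
  (forall x, 0 < H x -> f x = g x) -> image_is f H K -> image_is g H K.
Proof.
move=> fg fHK y; have /sums_toP[w [cw Dw] <-] := fHK y.
apply/sums_toP; exists w => //; split.
  move=> x gx; have [Hx|] := ltnP 0 (H x); first by apply: cw; rewrite /= fg.
  rewrite leqn0 => /eqP Hx; rewrite Hx; apply/count_memPn/negP => xw.
  have := cw x (Dw x xw); rewrite Hx; apply/count_memPn; by rewrite xw.
move=> x xw; rewrite /= -fg; first exact: Dw.
by rewrite -(cw x (Dw x xw)) -has_count has_pred1.
Qed.

Lemma image_inj f H K K' : image_is f H K -> image_is f H K' -> K = K'.
Proof. by move=> fK fK'; apply/funext => y; apply: sums_to_inj (fK y) (fK' y). Qed.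

Lemma imageD f H H' K K' : image_is f H K -> image_is f H' K' ->
  image_is f (fun x => H x + H' x) (fun y => K y + K' y).
Proof. by move=> fK fK' y; apply: sums_toD. Qed.

Lemma imageS f H H' K' : mle H H' -> image_is f H' K' ->
  exists K, image_is f H K.
Proof.
move=> leH fK'.
have /choice[K fK] y : exists n, sums_to [set x | f x = y] H n.
  by apply: sums_toS (fK' y) _.
by exists K.
Qed.

(** The difference has some image, and by additivity and uniqueness [K'] is [K] plus that image; the
    truncated subtraction is therefore exact. *)
Lemma image_sub f H H' K K' : mle H H' -> image_is f H K -> image_is f H' K' ->
  mle K K' /\ image_is f (fun x => H' x - H x) (fun y => K' y - K y).
Proof.
move=> leH fK fK'.
have [K0 fK0] : exists K0, image_is f (fun x => H' x - H x) K0.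
  by apply: imageS fK' => x; apply: leq_subr.
have E : K' = fun y => K y + K0 y.
  apply: image_inj fK' _; have := imageD fK fK0.
  by congr (image_is _ _ _); apply/funext => x; rewrite subnKC.
split=> [y|]; first by rewrite E leq_addr.
by congr (image_is _ _ _): fK0; apply/funext => y; rewrite E addKn.
Qed.

Lemma image_gt0 f H K x : image_is f H K -> 0 < H x -> 0 < K (f x).
Proof. by move=> fK; apply: sums_to_gt0 (fK (f x)) _. Qed.

End Image.

Section ImageComp.
Variables (X Y : choiceType) (Z : Type) (f : X -> Y) (g : Y -> Z).
Variables (H : X -> nat) (K : Y -> nat) (L : Z -> nat).
Hypothesis fK : image_is f H K.

(** Mapping a listing of [H] through [f] gives a listing of [K]: its part above [y] lists [H] on the
    fibre of [f] over [y]. *)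
Let sums_to_quot z n :
  sums_to [set x | g (f x) = z] H n -> sums_to [set y | g y = z] K n.
Proof.
move=> /sums_toP[w [cw Dw] <-].
apply/sums_toP; exists (map f w); last by rewrite size_map.
split=> [y gy|y /mapP[x /Dw + ->]//].
rewrite count_map -size_filter; apply: sums_to_inj (fK y); apply: lists_sums.
split=> [x fx|x]; last by rewrite mem_filter => /andP[/eqP].
rewrite count_filter -cw /= ?fx//; apply: eq_count => x' /=.
by have [->|//] := eqVneq x' x; rewrite fx eqxx.
Qed.

Lemma image_quot : image_is (fun x => g (f x)) H L -> image_is g K L.
Proof. by move=> gfL z; apply: sums_to_quot. Qed.

(** Only convergence is at stake: finitely many [y] over [z] carry weight, and [H] has finite
    support over each of them. The value then follows from [sums_to_quot]. *)
Lemma image_comp : image_is g K L -> image_is (fun x => g (f x)) H L.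
Proof.
move=> gL z; have /sums_toP[w [cw Dw] _] := gL z.
have /choice[v vP] y : exists v, lists [set x | f x = y] H v.
  by have /sums_toP[v lv _] := fK y; exists v.
have [W /lists_sums sW] : exists W, lists [set x | g (f x) = z] H W.
  apply: lists_finite.
  apply: (@sub_finite_set _ _ [set` flatten [seq v y | y <- w]]); last exact: finite_seq.
  move=> x [/= gfx /eqP Hx]; apply/flattenP; exists (v (f x)).
    apply: map_f; rewrite -has_pred1 has_count cw//.
    by apply: image_gt0 fK _; rewrite lt0n.
  by rewrite -has_pred1 has_count (vP _).1// lt0n.
by rewrite (sums_to_inj (gL z) (sums_to_quot sW)).
Qed.

End ImageComp.

(** Points of [D] missed by [i] carry weight 0, so the listings on both sides correspond through
    [map i]. *)
Lemma sums_to_reindex (X Y : choiceType) (i : X -> Y) (D : set Y) (H : Y -> nat) n :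
  injective i -> (forall y, D y -> 0 < H y -> exists x, i x = y) ->
  sums_to D H n <-> sums_to (i @^-1` D) (fun x => H (i x)) n.
Proof.
move=> inj_i surj; split=> /sums_toP[w [cw Dw] <-].
  have [v Ew] : exists v, w = map i v.
    have : forall y, y \in w -> exists x, i x = y.
      move=> y yw; apply: surj; first exact: Dw.
      by rewrite -cw -?has_count ?has_pred1//; apply: Dw.
    elim: w {cw Dw} => [|y w IH] wi; first by exists [::].
    have [y' y'w|v ->] := IH; first by apply: wi; rewrite in_cons y'w orbT.
    have [x <-] := wi y (mem_head _ _); by exists (x :: v).
  apply/sums_toP; exists v; last by rewrite Ew size_map.
  split=> [x ix|x xv]; last by apply: Dw; rewrite Ew map_f.
  rewrite -cw// Ew count_map; apply: eq_count => x' /=.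
  by rewrite (inj_eq inj_i).
apply/sums_toP; exists (map i w); last by rewrite size_map.
split=> [y Dy|y /mapP[x /Dw + ->]//].
have [/(surj _ Dy)[x xy]|] := ltnP 0 (H y).
  subst y; rewrite -cw// count_map; apply: eq_count => x' /=.
  by rewrite (inj_eq inj_i).
rewrite leqn0 => /eqP Hy; rewrite Hy; apply/count_memPn/negP => /mapP[x xw yE].
by have := cw x (Dw x xw); rewrite -yE Hy; apply/count_memPn; rewrite xw.
Qed.

Lemma image_reindex (X Y : choiceType) (Z : Type) (i : X -> Y) (g : Y -> Z)
    (H : Y -> nat) (K : Z -> nat) : injective i ->
  (forall y, 0 < H y -> exists x, i x = y) ->
  image_is g H K <-> image_is (fun x => g (i x)) (fun x => H (i x)) K.
Proof.
move=> inj_i surj.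
have R z := @sums_to_reindex _ _ i [set y | g y = z] H (K z) inj_i (fun y _ => surj y).
by split=> gK z; [apply/(R z).1|apply/(R z).2]; apply: gK.
Qed.

(** The second components are read off, position by position, from a listing of
    each row of [l] and one of the fibre of [f] it has to be matched with. *)
Lemma image_lift (X Y Z : choiceType) (d : X -> Z) (f : X -> Y)
    (H : X -> nat) (K : Y -> nat) (l : Y * Z -> nat) :
  (forall x, H x <= 1) -> image_is f H K ->
  (forall y, sums_to setT (fun z => l (y, z)) (K y)) ->
  exists g : X -> Z, image_is (fun x => (f x, g x)) H l.
Proof.
move=> H1 fK lK.
have /choice[w wP] y : exists w, lists [set x | f x = y] H w /\ size w = K y.
  by have /sums_toP[w lw sw] := fK y; exists w.
have /choice[v vP] y : exists v, lists setT (fun z => l (y, z)) v /\ size v = K y.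
  by have /sums_toP[v lv sv] := lK y; exists v.
have w_uniq y : uniq (w y).
  have [[cw Dw] _] := wP y; apply: count_mem_uniq => x.
  have [xw|] := boolP (x \in w y); last by move/count_memPn.
  by apply/eqP; rewrite eqn_leq -has_count has_pred1 xw cw ?H1//; apply: Dw.
(* The two listings have equal length, so a listed [x] never gets the default [d x], which only
   makes [g] total. *)
pose g x := nth (d x) (v (f x)) (index x (w (f x))).
have gE y : map g (w y) = v y.
  have [[[cw Dw] sw] [_ sv]] := (wP y, vP y).
  case wE: (w y) => [|x0 w']; first by apply/esym/size0nil; rewrite sv -sw wE.
  rewrite -wE; apply: (@eq_from_nth _ (d x0)); rewrite size_map sw ?sv// => i iK.
  have iw : i < size (w y) by rewrite sw.
  rewrite (nth_map x0)// /g (Dw (nth x0 (w y) i)) ?mem_nth// index_uniq//.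
  by apply: set_nth_default; rewrite sv.
exists g => -[y z]; have [[[cw Dw] sw] [[cv _] sv]] := (wP y, vP y).
apply/sums_toP; exists [seq x <- w y | g x == z]; last first.
  rewrite size_filter -cv// -gE count_map; exact: eq_count.
split=> [x [fx gx]|x]; last by rewrite mem_filter => /andP[/eqP <- /Dw <-].
rewrite -(cw x fx) count_filter; apply: eq_count => x' /=.
by have [->|//] := eqVneq x' x; rewrite gx eqxx.
Qed.

(** * Causal nets: causal order, cuts and layers *)

Section CausalNet.
Variables (Act : Type) (C : net Act).
Hypothesis cC : causal_net C.

Definition below (u t : trans C) : Prop := @flow_plus Act C (inr u) (inr t).

Definition dclosed (D : set (trans C)) : Prop :=
  forall u t, D t -> below u t -> D u.

Lemma below_place u t s : 0 < post u s -> 0 < pre t s -> below u t.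
Proof. by move=> us st; apply: (@t_trans _ _ _ (inl s)); apply: t_step. Qed.

Lemma below_trans u v t : below u v -> below v t -> below u t.
Proof. exact: t_trans. Qed.

Lemma below_seq (t : trans C) : exists w : seq (trans C), forall u, below u t -> u \in w.
Proof.
have /finite_seqP[w wE] := cn_finite cC t.
by exists w => u ut; have : [set` w] u by rewrite -wE.
Qed.

(** Induction on the length of a list containing all predecessors of [t]: passing to a predecessor
    [u] allows [u] itself to be removed, by acyclicity. *)
Lemma below_ind (P : trans C -> Prop) :
  (forall t, (forall u, below u t -> P u) -> P t) -> forall t, P t.
Proof.
move=> IP t; have [w tw] := below_seq t.
have [n] := ubnP (size w); elim: n w t tw => // n IHn w t tw wn.
apply: IP => u ut; apply: (IHn (rem u w)).
  move=> v vu; have [vu'|vNu] := eqVneq v u; last first.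
    have vw : v \in w by apply/tw/(below_trans vu).
    by move: vw; rewrite (perm_mem (perm_to_rem (tw u ut))) in_cons (negPf vNu).
  by subst v; case: (cn_acyclic cC vu).
by rewrite size_rem ?tw//; have := tw u ut; case: (w) wn.
Qed.

Lemma minimal_trans (P : set (trans C)) t :
  P t -> exists u, P u /\ forall v, below v u -> ~ P v.
Proof.
move=> Pt; apply: contrapT => noMin.
elim/below_ind: t Pt => t IH Pt.
by apply: noMin; exists t; split=> // v /IH.
Qed.

(** [D] grows by one minimal element of the remainder of [D'] at a time, and [D'] is finite. *)
Lemma dclosed_ind (P : set (trans C) -> Prop) (D D' : set (trans C)) :
  D `<=` D' -> finite_set D' -> dclosed D -> dclosed D' -> P D ->
  (forall E t, D `<=` E -> dclosed E -> ~ E t -> (forall u, below u t -> E u) -> P E ->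
     P (t |` E)) ->
  P D'.
Proof.
move=> DD' /finite_seqP[w wE] clD clD' PD step.
have [n] := ubnP (count (fun t => `[< ~ D t >]) w).
elim: n D DD' clD PD step => // n IHn D DD' clD PD step cn.
have [[t [D't Dt]]|noT] := pselect (exists t, D' t /\ ~ D t); last first.
  suff -> : D' = D by [].
  by apply/seteqP; split=> // t D't; apply: contrapT => Dt; apply: noT; exists t.
have [u [[D'u Du] uP]] := @minimal_trans (D' `\` D) t (conj D't Dt).
have uD v : below v u -> D v.
  by move=> vu; apply: contrapT => Dv; apply: (uP v vu); split=> //; apply: clD' vu.
have uw : u \in w by have : [set` w] u by rewrite -wE.
apply: (IHn (u |` D)).
- by move=> v [->|/DD'].
- move=> v t' [->|Dt'] vt'; right; [exact: uD|exact: clD vt'].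
- exact: step.
- by move=> E t' uDE; apply: step => v Dv; apply: uDE; right.
- rewrite ltnS in cn; apply: leq_trans cn.
  rewrite (permP (perm_to_rem uw)) [X in _ < X](permP (perm_to_rem uw)) /=.
  rewrite (asboolT Du) asboolF ?add0n ?add1n ?ltnS; last by apply; left.
  by apply: sub_count => v /asboolP Dv; apply/asboolP => D'v; apply: Dv; right.
Qed.

Lemma init_or_post (s : place C) : init s = 1 \/ exists t : trans C, 0 < post t s.
Proof.
have [/(cn_init1 cC)|/existsNP[t /eqP]] := pselect (forall t : trans C, post t s = 0).
  by left.
by rewrite -lt0n; right; exists t.
Qed.

Lemma init_le1 (s : place C) : init s <= 1.
Proof. by have [->|[t /(cn_init0 cC) ->]] := init_or_post s. Qed.

(** These places carry a token at some time while [D] fires, whether or not it has been consumed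
    since. *)
Definition live (D : set (trans C)) (s : place C) : Prop :=
  0 < init s \/ exists2 t, D t & 0 < post t s.

(** The marking reached by firing every transition of [D] exactly once. *)
Definition cut (D : set (trans C)) : marking C :=
  fun s => `[< live D s /\ forall t, D t -> pre t s = 0 >].

Lemma cut_live D s : 0 < cut D s -> live D s.
Proof. by rewrite /cut lt0b => /asboolP[]. Qed.

Lemma live_sub D E s : D `<=` E -> live D s -> live E s.
Proof. by move=> DE [|[t /DE]]; [left|right; exists t]. Qed.

Lemma live_pre D t s : (forall u, below u t -> D u) -> 0 < pre t s -> live D s.
Proof.
move=> tD st; have [s1|[u us]] := init_or_post s; first by left; rewrite s1.
by right; exists u => //; apply/tD/(below_place us st).
Qed.

Lemma live_post D t s : live D s -> 0 < post t s -> D t.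
Proof.
move=> [s0|[u Du us]] ts; first by rewrite (cn_init0 cC ts) in s0.
by rewrite (cn_post_uniq cC ts us).
Qed.


Lemma cut0 : cut set0 = @init Act C.
Proof.
apply/funext => s; rewrite /cut.
have [s1|[t ts]] := init_or_post s.
  by rewrite s1 asboolT//; split=> //; left; rewrite s1.
rewrite (cn_init0 cC ts) asboolF// => -[[|[u []]]].
by rewrite (cn_init0 cC ts).
Qed.

(** The producer of a preplace of [t], if any, has fired, and its only possible consumer [t] has
    not. *)
Lemma pre_le_cut D t :
  ~ D t -> (forall u, below u t -> D u) -> mle (pre t) (cut D).
Proof.
move=> Dt tD s; have [st|] := ltnP 0 (pre t s); last by rewrite leqn0 => /eqP ->.
apply: leq_trans (cn_pre_le1 cC t s) _; rewrite lt0b; apply/asboolP; split.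
  exact: live_pre st.
move=> u Du; apply/eqP; rewrite -leqn0 leqNgt; apply/negP => su.
by apply: Dt; rewrite (cn_pre_uniq cC st su).
Qed.

(** Places split into preplaces of [t], postplaces of [t] and the rest. Acyclicity separates the
    first two kinds. A postplace is unmarked before, as its only producer is outside [D], and has no
    consumer in [D], as [D] is downward closed. *)
Lemma cutU1 D t : dclosed D -> ~ D t -> (forall u, below u t -> D u) ->
  cut (t |` D) = fire (cut D) t.
Proof.
move=> clD Dt tD; apply/funext => s; rewrite /fire /=.
have [st|] := ltnP 0 (pre t s).
  have -> : cut (t |` D) s = 0.
    rewrite /cut asboolF// => -[_ /(_ t)]; case: (pre t s) st => // n _.
    by move=> /(_ (or_introl erefl)).
  have -> : post t s = 0.
    apply/eqP; rewrite -leqn0 leqNgt; apply/negP => ts.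
    exact: (cn_acyclic cC (below_place ts st)).
  rewrite addn0; apply/esym/eqP; rewrite subn_eq0.
  by apply: leq_trans st; rewrite /cut; case: asboolP.
rewrite leqn0 => /eqP pt0; rewrite pt0 subn0.
have [ts|] := ltnP 0 (post t s).
  have -> : post t s = 1 by apply/eqP; rewrite eqn_leq ts cn_post_le1.
  have -> : cut D s = 0.
    apply/eqP; rewrite -leqn0 leqNgt; apply/negP => /cut_live lDs.
    exact/Dt/(live_post lDs ts).
  rewrite /cut asboolT//; split; first by right; exists t => //; left.
  move=> u [->//|Du]; apply/eqP; rewrite -leqn0 leqNgt; apply/negP => su.
  exact/Dt/(clD _ _ Du)/(below_place ts su).
rewrite leqn0 => /eqP tp0; rewrite tp0 addn0 /cut; congr nat_of_bool.
apply/asbool_equiv_eq; split=> -[lv cs].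
  split=> [|u Du]; last by apply: cs; right.
  case: lv => [|[u [->|Du] us]]; [by left| by rewrite tp0 in us |by right; exists u].
split; first by apply: live_sub lv => u; right.
by move=> u [->//|/cs].
Qed.

Lemma cut_reachable D : finite_set D -> dclosed D -> reachable (cut D).
Proof.
move=> fD clD; apply: (@dclosed_ind (fun D => reachable (cut D)) set0 D) => //.
  by rewrite cut0; apply: rt_refl.
move=> E t _ clE Et tE rE; apply: rt_trans rE _; apply: rt_step.
by exists t; split; [exact: pre_le_cut|exact: cutU1].
Qed.

(** Layer [n] holds the transitions for which every causal chain of transitions ending there has at
    most [n] members. *)
Fixpoint layer n : set (trans C) :=
  if n is n'.+1 then [set t | forall u, below u t -> layer n' u] else set0.

Lemma layer_dclosed n : dclosed (layer n).
Proof.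
by case: n => [//|n] u t /= tP ut v vu; apply/tP/(below_trans vu).
Qed.

Lemma layerS n : layer n `<=` layer n.+1.
Proof. by move=> t lt u ut; apply: layer_dclosed ut. Qed.

Lemma layer_mono m n : m <= n -> layer m `<=` layer n.
Proof.
by move=> /subnKC <-; elim: (n - m) => [|k IH] t; rewrite ?addn0// addnS => /IH/layerS.
Qed.

(** If infinitely many transitions were new in layer [n.+1], all would be enabled at the reachable
    marking [cut (layer n)]. A place has at most one consumer, so their presets are disjoint and
    jointly below that marking, against bounded parallelism. *)
Lemma layer_finite n : finite_set (layer n).
Proof.
elim: n => [|n IHn]; first exact: finite_set0.
apply: contrapT => /infinite_setD/(_ IHn) infD.
pose U (t : trans C) : nat := `[< (layer n.+1 `\` layer n) t >].
have UE t : 0 < U t <-> (layer n.+1 `\` layer n) t.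
  by rewrite /U lt0b; split=> /asboolP.
apply: (@net_bounded _ C (cut (layer n)) U).
- exact: cut_reachable (@layer_dclosed n).
- by congr (infinite_set _): infD; apply/funext => t; rewrite /= (propext (UE t)).
move=> s; have [[t [/UE[tS tn] st]]|noT] := pselect (exists t, 0 < U t /\ 0 < pre t s).
  exists 1; last exact: leq_trans st (pre_le_cut tn tS s).
  apply/sums_toP; exists [:: t] => //; split=> // u _ /=; rewrite addn0.
  have [<-|ut] := eqVneq t u.
    by rewrite /U asboolT// mul1n; apply/esym/eqP; rewrite eqn_leq st cn_pre_le1.
  apply/esym/eqP; rewrite muln_eq0 orbC -leqn0 leqNgt; case: ltnP => //= su.
  by rewrite (cn_pre_uniq cC st su) eqxx in ut.
exists 0 => //; apply: sums_to0 => u _; apply/eqP.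
rewrite -leqn0 leqNgt muln_gt0; apply/negP => /andP[Uu su].
by apply: noT; exists u.
Qed.

Lemma layer_seq (w : seq (trans C)) : (forall u, u \in w -> exists n, layer n u) ->
  exists n, forall u, u \in w -> layer n u.
Proof.
elim: w => [|t w IH] tw; first by exists 0.
have [u uw|m mP] := IH; first by apply: tw; rewrite in_cons uw orbT.
have [k kt] := tw t (mem_head _ _).
exists (maxn m k) => u; rewrite in_cons => /orP[/eqP ->|/mP].
  by apply: layer_mono kt; rewrite leq_maxr.
by apply: layer_mono; rewrite leq_maxl.
Qed.

(** Each of the finitely many predecessors lies in some layer, and the largest of these layers
    contains them all. *)
Lemma layer_ex t : exists n, layer n t.
Proof.
elim/below_ind: t => t IH; have [w tw] := below_seq t.
have [|n nP] := @layer_seq [seq u <- w | `[< below u t >]].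
  by move=> u; rewrite mem_filter => /andP[/asboolP/IH].
exists n.+1 => u ut; apply: nP; rewrite mem_filter tw// andbT; exact/asboolP.
Qed.

Lemma live_layer s : exists n, live (layer n) s.
Proof.
have [s1|[t ts]] := init_or_post s; first by exists 0; left; rewrite s1.
have [n nt] := layer_ex t.
by exists n; right; exists t.
Qed.

End CausalNet.

(** * Linkings as multisets of pairs *)

Section Linkings.
Variables (Act : Type) (N1 N2 : petri_net Act).
Implicit Types l : linking N1 N2.

Lemma pi1_image l M : pi1_is l M <-> image_is fst l M.
Proof.
have R s : sums_to [set p | p.1 = s] l (M s) <-> sums_to setT (fun s2 => l (s, s2)) (M s).
  rewrite (@sums_to_reindex _ _ (pair s)); last 2 first.
  - by move=> x y [].
  - by move=> [s1 s2] /= -> _; exists s2.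
  by have -> : pair s @^-1` [set p | p.1 = s] = [set: place N2] by apply/seteqP.
by split=> lM s; apply/R.
Qed.

Lemma pi2_image l M : pi2_is l M <-> image_is snd l M.
Proof.
have R s : sums_to [set p | p.2 = s] l (M s) <-> sums_to setT (fun s1 => l (s1, s)) (M s).
  rewrite (@sums_to_reindex _ _ (pair^~ s)); last 2 first.
  - by move=> x y [].
  - by move=> [s1 s2] /= -> _; exists s1.
  by have -> : pair^~ s @^-1` [set p | p.2 = s] = [set: place N1] by apply/seteqP.
by split=> lM s; apply/R.
Qed.

End Linkings.

(** * Following a bisimulation along a causal net *)

Section Simulation.
Variables (Act : Type) (C N1 N2 : net Act) (F1 : folding C N1).
Hypothesis cC : causal_net C.
Variables (B : set (linking N1 N2)) (l0 : linking N1 N2).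
Hypothesis bisB : sp_bisimulation B.
Hypothesis Bl0 : B l0.
Hypothesis pi1_l0 : pi1_is l0 (@init Act N1).
Hypothesis pi2_l0 : pi2_is l0 (@init Act N2).

Local Notation rho1 := (fold_place F1).

(** This supplies the default map for [image_lift]. If [N2] had no place, all projections of
    linkings would vanish; then [C] would have no initial place and, by induction, no transition
    producing a place, hence no place at all. *)
Lemma place_map_inhabited : inhabited (place C -> place N2).
Proof.
suff /choice[d _] : forall s : place C, exists s2 : place N2, True by constructor.
move=> s.
apply: contrapT => noS2.
have no_init (s' : place C) : ~ 0 < init s'.
  move=> s'0; have := image_gt0 (fold_init F1) s'0.
  by move=> /(sums_to_ex (pi1_l0 _))[s2 _]; apply: noS2; exists s2.
have no_post (t : trans C) s' : ~ 0 < post t s'.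
  elim/(below_ind cC): t s' => t IH s' ts'.
  have t_pre0 s'' : pre t s'' = 0.
    apply/eqP; rewrite -leqn0 leqNgt; apply/negP => st.
    have [s1|[u us]] := init_or_post cC s''; first by apply: (no_init s''); rewrite s1.
    by apply: (IH u _ s'' us); apply: below_place us st.
  (* As [t] consumes nothing, its image is simulated from [l0] with the zero linking. *)
  have [|s1|t2 [c' [_ _ c'1 _ _]]] :=
    bisB.1 l0 (fun=> 0) (fold_trans F1 t) Bl0; first by [].
    suff -> : pre (fold_trans F1 t) s1 = 0 by apply: sums_to0.
    by apply: sums_to_inj (fold_pre F1 t s1) _; apply: sums_to0.
  have := image_gt0 (fold_post F1 t) ts'.
  by move=> /(sums_to_ex (c'1 _))[s2 _]; apply: noS2; exists s2.
have [s1|[u]] := init_or_post cC s; last exact: no_post.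
by apply: (no_init s); rewrite s1.
Qed.

(** A folding of the part of [C] generated by [D] into [N2], whose cut is related
    by [B] to the one under [F1].  The transitions are not chosen yet: the limit
    over all layers only has to glue the place components. *)
Definition simulates (D : set (trans C)) (rho : place C -> place N2) : Prop :=
  [/\ image_is rho (@init Act C) (@init Act N2),
      forall t, D t -> exists t2, [/\ lab t2 = lab t,
        image_is rho (pre t) (pre t2) & image_is rho (post t) (post t2)]
    & exists2 l, B l & image_is (fun s => (rho1 s, rho s)) (cut D) l].

(** All places that [simulates] speaks of are live under [D], so [rho] may be changed elsewhere. *)
Lemma simulates_ext (D : set (trans C)) rho rho' : dclosed D ->
  (forall s, live D s -> rho s = rho' s) -> simulates D rho -> simulates D rho'.
Proof.
move=> clD eq_rho [rho_init rho_trans [l Bl rho_cut]]; split.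
- by apply: image_ext rho_init => s s0; apply: eq_rho; left.
- move=> t Dt; have [t2 [labt pret postt]] := rho_trans t Dt.
  exists t2; split=> //.
    apply: image_ext pret => s st; apply/eq_rho/(live_pre cC _ st) => u.
    exact: clD.
  by apply: image_ext postt => s ts; apply: eq_rho; right; exists t.
- by exists l => //; apply: image_ext rho_cut => s /cut_live/eq_rho ->.
Qed.

Lemma simulates0 (d : place C -> place N2) : exists rho, simulates set0 rho.
Proof.
have [rho rhoP] := image_lift d (init_le1 cC) (fold_init F1) pi1_l0.
exists rho; split=> //; last by exists l0; rewrite ?(cut0 cC).
by apply: (image_comp (g := snd) rhoP); apply/pi2_image.
Qed.

(** The preset of [t] maps to a part [c] of [l] that projects to the preset of its image in [N1].
    The bisimulation answers with [t2] and [c'], and [image_lift] spreads [c'] over the postplaces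
    of [t]. These are not live under [D], so earlier choices survive. *)
Lemma simulatesU1 (d : place C -> place N2) (D : set (trans C)) t rho :
  dclosed D -> ~ D t -> (forall u, below u t -> D u) -> simulates D rho ->
  exists rho', simulates (t |` D) rho' /\ forall s, live D s -> rho s = rho' s.
Proof.
move=> clD Dt tD simD; have [rho_init rho_trans [l Bl rho_cut]] := simD.
have le_cut := pre_le_cut cC Dt tD.
have [c rho_pre] := imageS le_cut rho_cut.
have [le_cl rho_sub] := image_sub le_cut rho_pre rho_cut.
have c1 : pi1_is c (pre (fold_trans F1 t)).
  by apply/pi1_image; apply: (image_quot (g := fst) rho_pre); apply: fold_pre.
have [t2 [c' [labt /pi2_image c2 c'1 /pi2_image c'2 Bl']]] := bisB.1 _ _ _ Bl le_cl c1.
have [sigma sigmaP] := image_lift d (cn_post_le1 cC t) (fold_post F1 t) c'1.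
pose rho' s := if 0 < post t s then sigma s else rho s.
have rho'D s : live D s -> rho s = rho' s.
  by rewrite /rho'; case: ifP => // ts lDs; case: Dt; apply: live_post lDs ts.
have [rho'_init rho'_trans _] := simulates_ext clD rho'D simD.
have rho'_sub : image_is (fun s => (rho1 s, rho' s)) (fun s => cut D s - pre t s)
    (fun p => l p - c p).
  apply: image_ext rho_sub => s; rewrite subn_gt0 => lt_s.
  by rewrite rho'D//; apply: (@cut_live _ _ D); apply: leq_ltn_trans lt_s.
have rho'_post : image_is (fun s => (rho1 s, rho' s)) (post t) c'.
  by apply: image_ext sigmaP => s ts; rewrite /rho' ts.
exists rho'; split=> //; split=> //.
  move=> u [->|/rho'_trans//]; exists t2; split.
  - by rewrite labt fold_lab.
  - apply: (@image_ext _ _ rho) => [s st|]; last exact: (image_comp (g := snd) rho_pre).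
    exact/rho'D/(live_pre cC tD).
  - exact: (image_comp (g := snd) rho'_post).
exists (relink l c c') => //.
by rewrite (cutU1 cC clD Dt tD); apply: imageD.
Qed.

Lemma simulates_layers (d : place C -> place N2) : exists rho, forall n, simulates (layer n) rho.
Proof.
(* The condition on [f] makes [R] total, so that [choice] yields a function [next] on all pairs. *)
pose R n (f g : place C -> place N2) := simulates (layer n) f ->
  simulates (layer n.+1) g /\ forall s, live (layer n) s -> f s = g s.
have /choice[next nextP] (p : nat * (place C -> place N2)) : exists g, R p.1 p.2 g.
  case: p => n f; have [simf|nsim] := pselect (simulates (layer n) f);
    last by exists f => simf; case: nsim.
  suff [g [simg fg]] : exists g, simulates (layer n.+1) g /\
    forall s, live (layer n) s -> f s = g s by exists g.
  (* Layer [n.+1] is finite, so it is reached from layer [n] by single transitions. *)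
  apply: (dclosed_ind cC (D := layer n)
    (P := fun D => exists g, simulates D g /\ forall s, live (layer n) s -> f s = g s)).
  - exact: layerS.
  - exact: (layer_finite cC).
  - exact: layer_dclosed.
  - exact: (@layer_dclosed _ C n.+1).
  - by exists f.
  - move=> E t nE clE Et tE [g [simg fg]].
    have [h [simh gh]] := simulatesU1 d clE Et tE simg.
    by exists h; split=> // s ns; rewrite fg// gh//; apply: live_sub ns.
have [f0 sim0] := simulates0 d.
pose f := fix f n := if n is m.+1 then next (m, f m) else f0.
have simf n : simulates (layer n) (f n).
  by elim: n => [//|n IH]; have [] := nextP (n, f n) IH.
have f_stable m k s : live (layer m) s -> f (m + k) s = f m s.
  move=> ms; elim: k => [|k IHk]; first by rewrite addn0.
  rewrite addnS -IHk; have [_ /(_ s) /= ->//] := nextP (m + k, f (m + k)) (simf _).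
  by apply: live_sub ms; apply: layer_mono; rewrite leq_addr.
have /choice[h hP] := live_layer cC.
(* The value at [s] is frozen once [s] is live; it is read off at a layer [h s] where this holds,
   and stages [n] and [h s] are compared at their sum. *)
exists (fun s => f (h s) s) => n; apply: simulates_ext (simf n) => [|s ns].
  exact: layer_dclosed.
by rewrite -(f_stable _ (h s))// addnC f_stable.
Qed.

End Simulation.

(** * Extending a process by one transition *)

Section AddTransition.
Variables (Act : Type) (C N : net Act) (F : folding C N).
Hypothesis cC : causal_net C.
Variables (D : set (trans C)) (X : place C -> nat) (t1 : trans N).
Hypothesis fD : finite_set D.
Hypothesis clD : dclosed D.
Hypothesis X_cut : mle X (cut D).
Hypothesis X_end : forall s, 0 < X s -> forall t, pre t s = 0.
Hypothesis X_pre : image_is (fold_place F) X (pre t1).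

(** The new transition [None] consumes [X], a part of a cut whose places have no consumer in [C]. It
    gets one fresh postplace per token of [post t1], which keeps arc weights at 1 and lets it fold
    onto [t1]. *)
Definition add_place : choiceType := (place C + {s : place N & 'I_(post t1 s)})%type.
Definition add_trans : choiceType := option (trans C).

Definition add_pre (t : add_trans) (s : add_place) : nat :=
  match s, t with
  | inl s, Some t => pre t s
  | inl s, None => X s
  | inr _, _ => 0
  end.

Definition add_post (t : add_trans) (s : add_place) : nat :=
  match s, t with
  | inl s, Some t => post t s
  | inr _, None => 1
  | _, _ => 0
  end.

Definition add_init (s : add_place) : nat := if s is inl s then init s else 0.

Definition add_lab (t : add_trans) : Act := if t is Some t then lab t else lab t1.

Lemma add_lab_typ t : typ C (add_lab t).
Proof. by case: t => [t|] /=; [|rewrite (fold_typ F)]; apply: lab_typ. Qed.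

Definition add_petri : petri_net Act :=
  PetriNet add_pre add_post add_init add_lab_typ.

(** Firing the new transition only removes tokens from the old places, so every
    reachable marking is dominated on them by a reachable marking of [C]. *)
Lemma add_reachable (M : marking add_petri) : reachable M ->
  exists2 M0 : marking C, reachable M0 & forall s, M (inl s) <= M0 s.
Proof.
move=> rM; elim: {M rM} (clos_rt_rtn1 _ _ _ _ rM) => [|M' M'' [[t|] [enM' ->]] _ [M0 rM0 leM]].
- by exists (@init Act C) => //; apply: rt_refl.
- exists (fire M0 t) => [|s]; last by rewrite leq_add2r leq_sub2r.
  apply: rt_trans rM0 _; apply: rt_step; exists t; split=> // s.
  exact: leq_trans (enM' (inl s)) (leM s).
- by exists M0 => // s; rewrite /fire /= addn0; apply: leq_trans (leq_subr _ _) (leM s).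
Qed.

(** An infinite multiset stays infinite when [None] is dropped, and its demand on old places is
    bounded by a reachable marking of [C]. *)
Lemma add_bounded : bounded_parallelism add_petri.
Proof.
move=> M U /add_reachable[M0 rM0 leM] infU MU.
apply: (@net_bounded _ C M0 (fun t => U (Some t)) rM0).
  move=> fU; apply: infU.
  apply: (@sub_finite_set _ _ (None |` (Some @` [set t | 0 < U (Some t)]))).
    by move=> [t|] Ut; [right; exists t|left].
  by rewrite finite_setU; split; [exact: finite_set1|exact: finite_image].
move=> s; have [n /sums_toP[w [cw _] wn] nM] := MU (inl s).
exists (size (pmap id w)); last first.
  by rewrite size_pmap (leq_trans (count_size _ _))// wn (leq_trans nM).
apply: lists_sums; split=> // t _; rewrite -[RHS](cw (Some t))//.
by elim: w {cw wn} => //= -[t'|] w /= ->.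
Qed.

Definition add_net : net Act := Net add_bounded.

Local Notation elem := (place C + trans C)%type.

Let old (x : place add_net + trans add_net) : option elem :=
  match x with
  | inl (inl s) => Some (inl s)
  | inr (Some t) => Some (inr t)
  | _ => None
  end.

Let in_D (x : elem) : Prop := match x with inl s => live D s | inr t => D t end.

Let flow_plus_in_D (x y : elem) : @flow_plus Act C x y -> in_D y -> in_D x.
Proof.
elim=> {x y} [|x y z _ IHxy _ IHyz /IHyz/IHxy//].
move=> [s|t] [s'|t'] //= f_xy.
  by move=> Dt'; apply: live_pre f_xy => // u; apply: clD.
by move=> lDs; apply: live_post lDs f_xy.
Qed.

(** A transitive, irreflexive relation containing the flow of the extended net. No new element
    precedes an old one, and old elements preceding new ones lie in [D] or are live under it;
    finiteness of [D] thus bounds the causes of [None]. *)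
Let causes (x y : place add_net + trans add_net) : Prop :=
  match old x, old y with
  | Some a, Some b => @flow_plus Act C a b
  | Some a, None => in_D a
  | None, Some _ => False
  | None, None => x = inr None /\ y <> inr None
  end.

Let add_causes x y : @flow_plus Act add_net x y -> causes x y.
Proof.
elim=> {x y} [|x y z _ + _].
  move=> [[s|p]|[t|]] [[s'|p']|[t'|]] //= f_xy; try exact: t_step.
  by apply/cut_live/(leq_trans f_xy).
rewrite /causes; case: (old x) (old y) (old z) => [a|] [b|] [c|] //.
- exact: t_trans.
- exact: flow_plus_in_D.
- by move=> [-> _] [].
Qed.

Lemma add_causal : causal_net add_net.
Proof.
split.
- by move=> [t|] [s|p] //=; apply: cn_post_le1.
- move=> [t|] [t'|] [s|p] //= ts t's; congr Some; exact: (cn_post_uniq cC ts t's).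
- move=> [t|] [s|p] //=; first exact: cn_pre_le1.
  by apply: leq_trans (X_cut s) _; apply: leq_b1.
- move=> [t|] [t'|] [s|p] //= st st'.
    by congr Some; exact: (cn_pre_uniq cC st st').
    by rewrite (X_end st') in st.
  by rewrite (X_end st) in st'.
- move=> [s|p] post0; last by have := post0 None.
  by apply: (cn_init1 cC) => t; apply: (post0 (Some t)).
- by move=> [s|p] [t|] //= /(cn_init0 cC).
- move=> x /add_causes; rewrite /causes; case: (old x) => [a|[]//].
  exact: (cn_acyclic cC).
- move=> [t|].
    apply: (@sub_finite_set _ _ (Some @` [set u | @flow_plus Act C (inr u) (inr t)])).
      by move=> [u|] /add_causes //= ut; exists u.
    exact/finite_image/(cn_finite cC).
  apply: (@sub_finite_set _ _ (Some @` D)); last exact: finite_image.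
  by move=> [u|] /add_causes; [exists u|move=> [_ []]].
Qed.

Definition add_fold_place (s : place add_net) : place N :=
  match s with inl s => fold_place F s | inr p => tag p end.

Definition add_fold_trans (t : trans add_net) : trans N :=
  if t is Some t then fold_trans F t else t1.

Let add_image_old (H : place add_net -> nat) (K : place N -> nat) :
  (forall p, H (inr p) = 0) ->
  image_is (fold_place F) (fun s => H (inl s)) K -> image_is add_fold_place H K.
Proof.
move=> H0 FK; apply/(@image_reindex _ _ _ inl); last exact: FK.
- by move=> s s' [].
- by move=> [s|p]; [exists s|rewrite H0].
Qed.

Let add_image_new : image_is add_fold_place (add_post None) (post t1).
Proof.
move=> s; apply/sums_toP.
exists [seq inr (Tagged (fun s => 'I_(post t1 s)) i) | i <- enum 'I_(post t1 s)];
  last by rewrite size_map size_enum_ord.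
split; last by move=> x /mapP[i _ ->].
move=> [s'|[s' i]] /= ss'.
  by apply/count_memPn/negP => /mapP[].
subst s'; rewrite count_uniq_mem.
  by rewrite map_f// mem_enum.
rewrite map_inj_uniq ?enum_uniq// => i' j.
(* Comparing indices as naturals avoids equality of dependent pairs. *)
by move=> /(congr1 (fun x : add_place => if x is inr p then nat_of_ord (tagged p) else 0))/val_inj.
Qed.

(** Transparent, because [add_not_maximal] checks by computation that it restricts to [F]. *)
Definition add_folding : folding add_net N.
Proof.
apply: (@Folding _ add_net N add_fold_place add_fold_trans).
- exact: fold_typ F.
- by move=> [t|] //=; apply: fold_lab.
- exact/add_image_old/(fold_init F).
- by move=> [t|]; apply: add_image_old => //; apply: (fold_pre F).
- by move=> [t|]; [apply/add_image_old/(fold_post F)|apply: add_image_new].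
Defined.

Lemma add_not_maximal : ~ maximal (Process cC F).
Proof.
pose P := Process add_causal add_folding.
move=> /(_ P inl Some)[|_].
  split=> //.
  - by move=> s s' [].
  - by move=> [s|p] // ns; case: ns; exists s.
by move=> rT; have : [set: option (trans C)] None by []; rewrite -rT => -[].
Qed.

End AddTransition.

(** * Symmetry of sp-bisimilarity *)

Lemma sp_bisimulation_sym (Act : Type) (N1 N2 : petri_net Act)
    (B : set (linking N1 N2)) :
  sp_bisimulation B ->
  @sp_bisimulation Act N2 N1 [set l | B (fun p => l (p.2, p.1))].
Proof.
have swapK (M1 M2 : petri_net Act) (l : linking M1 M2) :
    (fun p => (fun q : place M2 * place M1 => l (q.2, q.1)) (p.2, p.1)) = l.
  by apply/funext => -[].
move=> [sim12 sim21]; split=> l c t /= Bl le_cl ct.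
  have [|t' [c' [labt ct' c'1 c'2 Bl']]] := sim21 _ (fun p => c (p.2, p.1)) t Bl _ ct.
    by move=> p; apply: le_cl.
  exists t', (fun p => c' (p.2, p.1)); split=> //.
  by congr (B _): Bl'; apply/funext => -[].
have [|t' [c' [labt ct' c'1 c'2 Bl']]] := sim12 _ (fun p => c (p.2, p.1)) t Bl _ ct.
  by move=> p; apply: le_cl.
exists t', (fun p => c' (p.2, p.1)); split=> //.
by congr (B _): Bl'; apply/funext => -[].
Qed.

Lemma sp_bisimilar_sym (Act : Type) (N1 N2 : petri_net Act) :
  sp_bisimilar N1 N2 -> sp_bisimilar N2 N1.
Proof.
move=> [typE [B [l [bisB Bl l1 l2]]]]; split; first by rewrite typE.
exists [set l | B (fun p => l (p.2, p.1))], (fun p => l (p.2, p.1)); split=> //.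
  exact: sp_bisimulation_sym.
by congr (B _): Bl; apply/funext => -[].
Qed.

(** * Old places in an extension of a process *)

Section Extensions.
Variables (Act : Type) (N : net Act) (P P' : process N).
Variables (iS : place (proc_net P) -> place (proc_net P')).
Variables (iT : trans (proc_net P) -> trans (proc_net P')).
Hypothesis ext : extends iS iT.

(** The folding fixes how many places of each kind a transition produces, so an
    old transition cannot acquire new postplaces. *)
Lemma extends_post_old t s' : 0 < post (iT t) s' -> range iS s'.
Proof.
move=> ts'; set y := fold_place (proc_fold P') s'.
have /sums_toP[w [cw Dw] wn] := fold_post (proc_fold P) t y.
have /sums_toP[w' [cw' Dw'] w'n] := fold_post (proc_fold P') (iT t) y.
have uniqw : uniq w.
  apply: count_mem_uniq => s; have [sw|] := boolP (s \in w); last by move/count_memPn.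
  apply/eqP; rewrite eqn_leq -has_count has_pred1 sw cw; last exact: Dw.
  by rewrite (cn_post_le1 (proc_causal P)).
(* The old postplaces over [y] are distinct members of [w'] and as many as its length, so they
   exhaust it. *)
have [|s sw||_ eqw] := @uniq_min_size _ (map iS w) w'.
- by rewrite map_inj_uniq//; apply: ext_place_inj ext.
- case/mapP: sw => x xw ->; have Dx := Dw x xw.
  rewrite -has_pred1 has_count cw' /= ?(ext_fold_place ext)//.
  by rewrite (ext_post ext) -(cw x Dx) -has_count has_pred1.
- by rewrite size_map wn w'n (ext_fold_trans ext).
have : s' \in w' by rewrite -has_pred1 has_count cw'.
by rewrite -eqw => /mapP[s _ ->]; exists s.
Qed.

(** A new place is initially unmarked, hence has a producer, and an old producer has only old
    postplaces. *)
Lemma extends_old_place s' :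
  (forall t', 0 < post t' s' -> range iT t') -> range iS s'.
Proof.
move=> s'T; apply: contrapT => nS; have s'0 := ext_init_new ext nS.
have [|[t' t's']] := init_or_post (proc_causal P') s'; first by rewrite s'0.
have [t _ tE] := s'T t' t's'.
by apply: nS; apply: (@extends_post_old t); rewrite tE.
Qed.

End Extensions.

(** * Transfer of maximality *)

Section Transfer.
Variables (Act : Type) (C N1 N2 : net Act).
Variables (F1 : folding C N1) (F2 : folding C N2) (B : set (linking N1 N2)).
Hypothesis cC : causal_net C.
Hypothesis bisB : sp_bisimulation B.
Hypothesis simF2 : forall n, simulates F1 B (layer n) (fold_place F2).

(** A minimal new transition of an extension of [F2] has its preset in a cut of
    [C], where it can be matched by a transition of [N1]. *)
Lemma maximal_transfer : maximal (Process cC F1) -> maximal (Process cC F2).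
Proof.
move=> max1 P' iS iT ext.
have iT_onto u : range iT u.
  apply: contrapT => nu; have cP' := proc_causal P'.
  have [{nu}u [nu uP]] := minimal_trans cP' (P := ~` range iT) nu.
  have u_old v : below v u -> range iT v by move=> /uP/contrapT.
  pose X s : nat := pre u (iS s).
  (* A consumer of such a place in [C] would coincide with [u] in the extension, but [u] is new. *)
  have X_end s : 0 < X s -> forall t, pre t s = 0.
    move=> su t; apply/eqP; rewrite -leqn0 leqNgt; apply/negP => st.
    apply: nu; exists t => //; rewrite -(ext_pre ext) in st.
    by rewrite /X in su; apply: (cn_pre_uniq cP' st su).
  (* The finitely many causes of [u] fit into one layer, whose cut will contain the preset of
     [u]. *)
  have [n nP] : exists n, forall t, below (iT t) u -> layer n t.
    have /finite_seqP[w wE] : finite_set (iT @^-1` [set v | below v u]).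
      apply: finite_preimage; last exact: (cn_finite cP').
      by move=> x y _ _; apply: ext_trans_inj ext _ _.
    have [t _|n wn] := @layer_seq _ C w; first exact: layer_ex.
    by exists n => t tu; apply: wn; have : [set` w] t by rewrite -wE.
  have X_cut : mle X (cut (layer n)).
    move=> s; have [su|] := ltnP 0 (X s); last by rewrite leqn0 => /eqP ->.
    apply: leq_trans (cn_pre_le1 cP' u (iS s)) _; rewrite lt0b; apply/asboolP.
    split=> [|t _]; last exact: X_end.
    have [s1|[t' t's]] := init_or_post cP' (iS s).
      by left; rewrite -(ext_init ext) s1.
    have t'u := below_place t's su.
    have [t _ tE] := u_old _ t'u; right; exists t; first by apply: nP; rewrite tE.
    by rewrite -(ext_post ext) tE.
  have X_pre : image_is (fold_place F2) X (pre (fold_trans (proc_fold P') u)).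
    have -> : fold_place F2 = fun s => fold_place (proc_fold P') (iS s).
      by apply/funext => s; rewrite (ext_fold_place ext).
    apply/(image_reindex _ _ (ext_place_inj ext)); last exact: fold_pre.
    (* Producers of preplaces of [u] are old by minimality, hence so are the preplaces. *)
    move=> s' s'u; suff [s _ sE] : range iS s' by exists s.
    apply: (extends_old_place ext) => t' t's'.
    by apply/u_old/(below_place t's' s'u).
  have [_ _ [l Bl l_cut]] := simF2 n.
  have [c c_pre] := imageS X_cut l_cut.
  have [le_cl _] := image_sub X_cut c_pre l_cut.
  have c2 : pi2_is c (pre (fold_trans (proc_fold P') u)).
    by apply/pi2_image; apply: (image_quot (g := snd) c_pre).
  (* The backward clause gives a transition of [N1] with preset the first projection of [c]; adding
     it with preset [X] properly extends the process over [N1]. *)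
  have [t1 [_ [_ /pi1_image c1 _ _ _]]] := bisB.2 _ _ _ Bl le_cl c2.
  apply: (add_not_maximal (layer_finite cC n) (@layer_dclosed _ _ n) X_cut X_end _ max1).
  exact: (image_comp (g := fst) c_pre c1).
split; last by apply/seteqP; split=> // u _; apply: iT_onto.
apply/seteqP; split=> // s' _.
by apply: (extends_old_place ext) => t' _; apply: iT_onto.
Qed.

End Transfer.

(** * Complete causal nets of sp-bisimilar nets *)

Lemma complete_causal_net_sp (Act : Type) (N1 N2 C : net Act) :
  sp_bisimilar N1 N2 -> complete_causal_net N1 C -> complete_causal_net N2 C.
Proof.
move=> [typE [B [l [bisB Bl l1 l2]]]] [[C' cC F1] [/= max1 CE]]; subst C'.
have [rho simrho] : exists rho, forall n, simulates F1 B (layer n) rho.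
  have [d] := place_map_inhabited F1 cC bisB Bl l1.
  exact: (simulates_layers F1 cC bisB Bl l1 l2 d).
(* With the place map fixed for all layers, each transition gets its image from any layer containing
   it. *)
have /choice[rhoT rhoTP] t : exists t2, [/\ lab t2 = lab t,
    image_is rho (pre t) (pre t2) & image_is rho (post t) (post t2)].
  by have [n nt] := layer_ex cC t; have [_ /(_ t nt)] := simrho n.
have [rho_init _ _] := simrho 0.
have typC : typ C = typ N2 by rewrite -typE; apply: fold_typ F1.
pose F2 := @Folding Act C N2 rho rhoT typC
  (fun t => let: And3 e _ _ := rhoTP t in e) rho_init
  (fun t => let: And3 _ e _ := rhoTP t in e) (fun t => let: And3 _ _ e := rhoTP t in e).
exists (Process cC F2); split=> //.
exact: (maximal_transfer bisB (F2 := F2) simrho max1).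
Qed.

Theorem theorem8 (Act : Type) (N1 N2 : net Act) :
  sp_bisimilar N1 N2 -> cc_equiv N1 N2.
Proof.
by move=> bis C; split; apply: complete_causal_net_sp => //; apply: sp_bisimilar_sym.
Qed.
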